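(* Let $X_1,\dots,X_m\in\mathbb{M}_n$ be such that their sum $\sum_{k=1}^m X_k$ is polar Hermitian. Then, for all integers $j=0,1,\ldots$, $$ \lambda^{\downarrow}_{1+2j}\left(\left|\sum_{k=1}^m X_k\right|_{\mathrm{sym}}\right)\le\lambda^{\downarrow}_{1+j}\left(\sum_{k=1}^m |X_k|_{\mathrm{sym}}\right). $$
   Context: $\mathbb{M}_n$ is the space of complex $n\times n$ matrices. For $Z\in\mathbb{M}_n$, $|Z|=(Z^*Z)^{1/2}$ and $|Z|_{\mathrm{sym}}=\frac{|Z|+|Z^*|}{2}$. A matrix $S\in\mathbb{M}_n$ is called polar Hermitian if it has a polar decomposition $S=V|S|$ (with $V$ unitary) in which $V$ is a scalar multiple of a Hermitian unitary. For a positive semidefinite $S\in\mathbb{M}_n$, $\lambda_1^{\downarrow}(S)\ge\cdots\ge\lambda_n^{\downarrow}(S)$ are its eigenvalues in nonincreasing order counted with multiplicity, with the convention $\lambda_k^{\downarrow}(S)=0$ for $k>n$. *)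

(* Defs.v *)
From mathcomp Require Import all_boot all_order all_algebra.
From mathcomp Require Import complex.
From mathcomp Require Import reals.

Set Implicit Arguments.
Unset Strict Implicit.
Unset Printing Implicit Defensive.

Import Order.TTheory GRing.Theory Num.Theory.
Local Open Scope ring_scope.
Local Open Scope sesquilinear_scope.

Section Definitions.
Variable C : numClosedFieldType.

(* The square root of a positive semidefinite matrix, by functional calculus on
   A = invmx (spectralmx A) *m diag_mx (spectral_diag A) *m spectralmx A;
   no meaning is attached to it when A is not positive semidefinite. *)
Definition sqrtmx n (A : 'M[C]_n) : 'M[C]_n :=
  invmx (spectralmx A) *m diag_mx (map_mx sqrtC (spectral_diag A))
    *m spectralmx A.

Definition psdmx n (A : 'M[C]_n) : Prop :=
  A \is hermsymmx /\ forall u : 'rV[C]_n, 0 <= (u *m A *m u^t*) 0 0.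

Definition absmx n (Z : 'M[C]_n) : 'M[C]_n := sqrtmx (Z^t* *m Z).

Definition symabsmx n (Z : 'M[C]_n) : 'M[C]_n :=
  2^-1 *: (absmx Z + absmx (Z^t*)).

Definition polar_hermitian n (S : 'M[C]_n) : Prop :=
  exists V : 'M[C]_n,
    [/\ V \is unitarymx,
        S = V *m absmx S &
        exists (c : C) (U : 'M[C]_n),
          [/\ U \is hermsymmx, U \is unitarymx & V = c *: U]].

(* Roots of the characteristic polynomial, listed with multiplicity. *)
Definition eigenvalues n (A : 'M[C]_n) : seq C :=
  sval (closed_field_poly_normal (char_poly A)).

(* k is 1-based, and the value is 0 for k > n.  The order of C is partial, but
   total on the reals, where the eigenvalues of a Hermitian matrix lie. *)
Definition lambda_desc (k : nat) n (A : 'M[C]_n) : C :=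
  (sort >=%R (eigenvalues A))`_k.-1.

Lemma spectral_diag_ge0 n (A : 'M[C]_n) i :
  psdmx A -> 0 <= spectral_diag A 0 i.
Proof.
move=> [/hermitian_normalmx/orthomx_spectralP eqA Age0].
have PU := spectral_unitarymx A.
suff -> : spectral_diag A 0 i =
    (row i (spectralmx A) *m A *m (row i (spectralmx A))^t*) 0 0 by [].
transitivity ((spectralmx A *m A *m (spectralmx A)^t*) i i); last first.
  rewrite -row_mul [LHS]mxE [RHS]mxE; apply: eq_bigr => k _.
  by rewrite !mxE.
rewrite [X in _ *m X *m _]eqA invmx_unitary // !mulmxA (unitarymxP PU) mul1mx.
by rewrite -mulmxA (unitarymxP PU) mulmx1 mxE eqxx mulr1n.
Qed.

Lemma gram_psd n (Z : 'M[C]_n) : psdmx (Z^t* *m Z).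
Proof.
split=> [|u].
  by apply/is_hermitianmxP; rewrite expr0 scale1r trmx_mul map_mxM trmxCK.
rewrite mulmxA -mulmxA -[Z in _ *m (Z *m _)]trmxCK -map_mxM -trmx_mul.
by rewrite mxE sumr_ge0 // => k _; rewrite !mxE mul_conjC_ge0.
Qed.

Lemma sqrtmxK n (A : 'M[C]_n) : psdmx A -> sqrtmx A *m sqrtmx A = A.
Proof.
move=> [/hermitian_normalmx/orthomx_spectralP eqA _].
rewrite [RHS]eqA /sqrtmx !mulmxA mulmxK ?spectral_unit //.
congr (_ *m _); rewrite -mulmxA mulmx_diag; congr (_ *m diag_mx _).
by apply/rowP => k; rewrite !mxE -expr2 sqrtCK.
Qed.

Lemma sqrtmx_psd n (A : 'M[C]_n) : psdmx A -> psdmx (sqrtmx A).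
Proof.
move=> Apsd; pose d := map_mx sqrtC (map_mx sqrtC (spectral_diag A)).
have d_ge0 k : 0 <= d 0 k by rewrite !mxE !sqrtC_ge0 spectral_diag_ge0.
suff -> : sqrtmx A = (diag_mx d *m spectralmx A)^t* *m (diag_mx d *m spectralmx A).
  exact: gram_psd.
rewrite trmx_mul map_mxM tr_diag_mx map_diag_mx.
have -> : map_mx Num.conj d = d.
  by apply/rowP => k; rewrite mxE geC0_conj.
rewrite /sqrtmx invmx_unitary ?spectral_unitarymx // mulmxA.
rewrite -[in RHS](mulmxA _ (diag_mx _)) mulmx_diag.
congr (_ *m diag_mx _ *m _).
by apply/rowP => k; rewrite !mxE -expr2 sqrtCK.
Qed.

End Definitions.

(* Main.v *)
Require Import Defs.
From mathcomp Require Import all_boot all_order all_algebra.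
From mathcomp Require Import complex.
From mathcomp Require Import reals.
From mathcomp Require Import ring.

Set Implicit Arguments.
Unset Strict Implicit.
Unset Printing Implicit Defensive.

Import Order.TTheory GRing.Theory Num.Theory.
Local Open Scope ring_scope.
Local Open Scope sesquilinear_scope.

(** Write P for the modulus of the sum S = \sum_k X k, T for symabsmx S and H
    for \sum_k symabsmx (X k).  The argument has three ingredients.

    The first is a bound on quadratic forms.  If X = W P is a polar
    decomposition, then the modulus of the adjoint of X is W P W^t*, and
    splitting P as the square of P^(1/2) turns u X u^t* into an inner product;
    the inequality of arithmetic and geometric means then gives
    Re (z * u X u^t* ) <= u (symabsmx X) u^t* for every z of modulus 1
    ([qform_symabsmx]).  This bound is additive in X, so that H dominates
    Re (z S) for every such z.

    The second uses the hypothesis on S.  If S = c U P with U a Hermitian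
    unitary matrix, then T = (P + U P U) / 2 is the modulus of the Hermitian
    matrix K = (U P + P U) / 2, because both have the same square.  Since K and
    -K are the Hermitian parts of z S for z = c^* and z = - c^*, both are
    dominated by H ([polar_hermitian_comparison]).

    The third is a count.  The eigenvalues of T are the absolute values of those
    of K.  Hence, with t the eigenvalue of T of rank 1 + 2 j, at least 1 + 2 j
    eigenvalues of K lie outside the open interval from -t to t, and 1 + j of
    them lie on the same side ([pigeonhole_sign]).  As H dominates both K and
    -K, at least 1 + j eigenvalues of H are at least t ([card_ge_udiag_mono], a
    form of Weyl's monotonicity principle). *)

(** * Adjoints and quadratic forms *)

Lemma adjmxM {C : numClosedFieldType} m n p (A : 'M[C]_(m, n))
    (B : 'M[C]_(n, p)) : (A *m B)^t* = B^t* *m A^t*.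
Proof. by rewrite trmx_mul map_mxM. Qed.

Lemma adjmxD {C : numClosedFieldType} m n (A B : 'M[C]_(m, n)) :
  (A + B)^t* = A^t* + B^t*.
Proof. by rewrite linearD /= map_mxD. Qed.

Lemma adjmxB {C : numClosedFieldType} m n (A B : 'M[C]_(m, n)) :
  (A - B)^t* = A^t* - B^t*.
Proof. by rewrite linearB /= map_mxB. Qed.

Lemma adjmxZ {C : numClosedFieldType} m n (c : C) (A : 'M[C]_(m, n)) :
  (c *: A)^t* = c^* *: A^t*.
Proof. by rewrite linearZ /= map_mxZ. Qed.

Lemma hermsymmx_adjP {C : numClosedFieldType} n (A : 'M[C]_n) :
  A \is hermsymmx <-> A^t* = A.
Proof.
split=> [/is_hermitianmxP|hA]; first by rewrite expr0 scale1r => <-.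
by apply/is_hermitianmxP; rewrite expr0 scale1r hA.
Qed.

Lemma gram_mx00 {C : numClosedFieldType} n (u : 'rV[C]_n) :
  (u *m u^t*) 0 0 = \sum_i `|u 0 i| ^+ 2.
Proof. by rewrite mxE; apply: eq_bigr => i _; rewrite !mxE normCK. Qed.

(** The j-th diagonal entry of N^t* N is the squared norm of the j-th column
    of N. *)
Lemma adjmx_mul_eq0 {C : numClosedFieldType} m n (N : 'M[C]_(m, n)) :
  N^t* *m N = 0 -> N = 0.
Proof.
move=> N0; apply/matrixP => i j; rewrite mxE.
have /matrixP/(_ j j) := N0; rewrite !mxE => /eqP.
under eq_bigr do rewrite !mxE mulrC -normCK.
rewrite psumr_eq0 => [/allP/(_ i (mem_index_enum i))|k _]; last first.
  exact: exprn_ge0.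
by rewrite /= expf_eq0 /= normr_eq0 => /eqP.
Qed.

Definition qform {C : numClosedFieldType} n (A : 'M[C]_n) (u : 'rV[C]_n) : C :=
  (u *m A *m u^t*) 0 0.

Lemma qformD {C : numClosedFieldType} n (A B : 'M[C]_n) u :
  qform (A + B) u = qform A u + qform B u.
Proof. by rewrite /qform mulmxDr mulmxDl mxE. Qed.

Lemma qformB {C : numClosedFieldType} n (A B : 'M[C]_n) u :
  qform (A - B) u = qform A u - qform B u.
Proof. by rewrite /qform mulmxBr mulmxBl !mxE. Qed.

Lemma qformZ {C : numClosedFieldType} n c (A : 'M[C]_n) u :
  qform (c *: A) u = c * qform A u.
Proof. by rewrite /qform -scalemxAr -scalemxAl mxE. Qed.

Lemma qform_sum {C : numClosedFieldType} n (I : finType) (A : I -> 'M[C]_n) u :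
  qform (\sum_k A k) u = \sum_k qform (A k) u.
Proof. by rewrite /qform mulmx_sumr mulmx_suml summxE. Qed.

Lemma qform_adj {C : numClosedFieldType} n (A : 'M[C]_n) u :
  qform (A^t*) u = (qform A u)^*.
Proof.
rewrite /qform; set M := u *m A *m u^t*.
suff -> : u *m A^t* *m u^t* = M^t* by rewrite !mxE.
by rewrite !adjmxM trmxCK mulmxA.
Qed.

Lemma qform_conj {C : numClosedFieldType} n (W A : 'M[C]_n) u :
  qform (W *m A *m W^t*) u = qform A (u *m W).
Proof. by rewrite /qform adjmxM !mulmxA. Qed.

Lemma psdmx_conj {C : numClosedFieldType} n (W A : 'M[C]_n) :
  psdmx A -> psdmx (W *m A *m W^t*).
Proof.
move=> [/hermsymmx_adjP hA A0]; split=> [|u].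
  by apply/hermsymmx_adjP; rewrite !adjmxM trmxCK hA mulmxA.
by rewrite -/(qform _ u) qform_conj; apply: A0.
Qed.

Lemma psdmxD {C : numClosedFieldType} n (A B : 'M[C]_n) :
  psdmx A -> psdmx B -> psdmx (A + B).
Proof.
move=> [/hermsymmx_adjP hA A0] [/hermsymmx_adjP hB B0]; split=> [|u].
  by apply/hermsymmx_adjP; rewrite adjmxD hA hB.
by rewrite -/(qform _ u) qformD addr_ge0 //; [apply: A0 | apply: B0].
Qed.

Lemma psdmxZ {C : numClosedFieldType} n (c : C) (A : 'M[C]_n) :
  0 <= c -> psdmx A -> psdmx (c *: A).
Proof.
move=> c0 [/hermsymmx_adjP hA A0]; split=> [|u].
  by apply/hermsymmx_adjP; rewrite adjmxZ hA geC0_conj.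
by rewrite -/(qform _ u) qformZ mulr_ge0 //; apply: A0.
Qed.

Lemma psdmx0 {C : numClosedFieldType} n : psdmx (0 : 'M[C]_n).
Proof.
split=> [|u]; first by apply/hermsymmx_adjP; rewrite trmx0 map_mx0.
by rewrite mulmx0 mul0mx mxE.
Qed.

(** * Matrices diagonal in an orthonormal basis *)

(** The spectral theorem makes every Hermitian matrix a [udiag]; having the
    eigenvalues as an explicit family [d] reduces the functional calculus and
    the counting of eigenvalues to statements on that family. *)
Definition udiag {C : numClosedFieldType} n (F : 'M[C]_n) (d : 'I_n -> C) :
  'M[C]_n := F^t* *m diag_mx (\row_i d i) *m F.

Lemma eq_udiag {C : numClosedFieldType} n (F : 'M[C]_n) (d e : 'I_n -> C) :
  d =1 e -> udiag F d = udiag F e.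
Proof.
by move=> de; rewrite /udiag; congr (_ *m diag_mx _ *m _); apply/rowP => i;
  rewrite !mxE de.
Qed.

Lemma udiag0 {C : numClosedFieldType} n (F : 'M[C]_n) : udiag F (fun=> 0) = 0.
Proof.
rewrite /udiag (_ : diag_mx _ = 0) ?mulmx0 ?mul0mx //.
by apply/matrixP => i j; rewrite !mxE mul0rn.
Qed.

Lemma unitarymxKl {C : numClosedFieldType} n (F : 'M[C]_n) :
  F \is unitarymx -> F^t* *m F = 1%:M.
Proof. by move=> /unitarymxP/mulmx1C. Qed.

Lemma udiag1 {C : numClosedFieldType} n (F : 'M[C]_n) :
  F \is unitarymx -> udiag F (fun=> 1) = 1%:M.
Proof.
move=> uF; rewrite /udiag (_ : diag_mx _ = 1%:M) ?mulmx1 ?unitarymxKl //.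
by apply/matrixP => i j; rewrite !mxE.
Qed.

Lemma udiagB {C : numClosedFieldType} n (F : 'M[C]_n) (d e : 'I_n -> C) :
  udiag F d - udiag F e = udiag F (fun i => d i - e i).
Proof.
rewrite /udiag -mulmxBl -mulmxBr; congr (_ *m _ *m _).
by apply/matrixP => i j; rewrite !mxE mulrnBl.
Qed.

Lemma udiagM {C : numClosedFieldType} n (F : 'M[C]_n) (d e : 'I_n -> C) :
  F \is unitarymx -> udiag F d *m udiag F e = udiag F (fun i => d i * e i).
Proof.
move=> /unitarymxP uF; rewrite /udiag !mulmxA.
rewrite -(mulmxA _ F) uF mulmx1 -(mulmxA _ (diag_mx _) (diag_mx _)) mulmx_diag.
by congr (_ *m diag_mx _ *m _); apply/rowP => i; rewrite !mxE.
Qed.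

Lemma udiag_adj {C : numClosedFieldType} n (F : 'M[C]_n) (d : 'I_n -> C) :
  (udiag F d)^t* = udiag F (fun i => (d i)^*).
Proof.
rewrite /udiag !adjmxM trmxCK mulmxA tr_diag_mx map_diag_mx.
by congr (_ *m diag_mx _ *m _); apply/rowP => i; rewrite !mxE.
Qed.

Lemma qform_udiag {C : numClosedFieldType} n (F : 'M[C]_n) (d : 'I_n -> C) u :
  qform (udiag F d) u = \sum_i d i * `|(u *m F^t*) 0 i| ^+ 2.
Proof.
have -> : qform (udiag F d) u
  = ((u *m F^t*) *m diag_mx (\row_i d i) *m (u *m F^t*)^t*) 0 0.
  by rewrite /qform /udiag adjmxM trmxCK !mulmxA.
move: (u *m F^t*) => v; rewrite mul_mx_diag mxE; apply: eq_bigr => i _.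
by rewrite !mxE normCK mulrAC mulrC.
Qed.

Lemma gram_mx00_unitary {C : numClosedFieldType} n (F : 'M[C]_n)
    (u : 'rV[C]_n) :
  F \is unitarymx -> (u *m u^t*) 0 0 = \sum_i `|(u *m F^t*) 0 i| ^+ 2.
Proof.
by move=> uF; rewrite -gram_mx00 adjmxM trmxCK !mulmxA mulmxKtV.
Qed.

Lemma udiag_psd {C : numClosedFieldType} n (F : 'M[C]_n) (d : 'I_n -> C) :
  (forall i, 0 <= d i) -> psdmx (udiag F d).
Proof.
move=> d0; split=> [|u].
  apply/hermsymmx_adjP; rewrite udiag_adj; apply: eq_udiag => i.
  by rewrite geC0_conj.
rewrite -/(qform _ u) qform_udiag sumr_ge0 // => i _.
by rewrite mulr_ge0 // exprn_ge0.
Qed.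

Lemma udiag_spectral {C : numClosedFieldType} n (A : 'M[C]_n) :
  A \is hermsymmx -> A = udiag (spectralmx A) (spectral_diag A 0).
Proof.
move=> /hermitian_normalmx/orthomx_spectralP {1}->.
rewrite invmx_unitary ?spectral_unitarymx // /udiag.
by congr (_ *m diag_mx _ *m _); apply/rowP => i; rewrite !mxE.
Qed.

Lemma spectral_diag_real {C : numClosedFieldType} n (A : 'M[C]_n) i :
  A \is hermsymmx -> spectral_diag A 0 i \is Num.real.
Proof. by move=> /hermitian_spectral_diag_real/mxOverP. Qed.

(** A matrix similar to a diagonal one has the same characteristic polynomial,
    and the latter splits with the diagonal entries as roots. *)
Lemma eigenvalues_udiag {C : numClosedFieldType} n (F : 'M[C]_n)
    (d : 'I_n -> C) :
  F \is unitarymx -> perm_eq (eigenvalues (udiag F d)) (codom d).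
Proof.
move=> /unitarymxKl uF; rewrite /eigenvalues.
case: closed_field_poly_normal => s /= Es; apply: prod_XsubC_eq.
have /monicP lc1 := char_poly_monic (udiag F d).
rewrite -[LHS]scale1r -{1}lc1 -{}Es.
rewrite big_map big_enum /=.
transitivity (char_poly (diag_mx (\row_i d i))); last first.
  rewrite char_poly_trig; last exact/is_diag_mx_is_trig/diag_mx_is_diag.
  by apply: eq_bigr => i _; rewrite !mxE eqxx mulr1n.
pose P := map_mx polyC F; pose Q := map_mx polyC (F^t*).
have QP : Q *m P = 1%:M by rewrite -map_mxM uF map_mx1.
rewrite /char_poly.
have -> : char_poly_mx (udiag F d)
    = Q *m char_poly_mx (diag_mx (\row_i d i)) *m P.
  rewrite /char_poly_mx mulmxBr mulmxBl -!map_mxM; congr (_ - _).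
  by rewrite mul_mx_scalar -scalemxAl QP scale_scalar_mx mulr1.
by rewrite !det_mulmx mulrAC -det_mulmx QP det1 mul1r.
Qed.

(** * Square roots and polar decompositions *)

(** Uniqueness of the positive semidefinite square root.  Let v be a unit
    eigenvector of D = P - Q, with eigenvalue d.  As D P + Q D = P^2 - Q^2 = 0,
    its quadratic form at v vanishes, that is, d * (v P v^t* + v Q v^t* ) = 0.
    If d were nonzero, then both forms would vanish at v, hence so would their
    difference, which is d. *)
Lemma psdmx_sqr_inj {C : numClosedFieldType} n (P Q : 'M[C]_n) :
  psdmx P -> psdmx Q -> P *m P = Q *m Q -> P = Q.
Proof.
move=> [/hermsymmx_adjP hP P0] [/hermsymmx_adjP hQ Q0] PQ.
have hD : P - Q \is hermsymmx by apply/hermsymmx_adjP; rewrite adjmxB hP hQ.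
pose F := spectralmx (P - Q); pose d := spectral_diag (P - Q) 0.
have ED : P - Q = udiag F d := udiag_spectral hD.
have uF : F \is unitarymx := spectral_unitarymx _.
suff d0 i : d i = 0.
  apply/eqP; rewrite -subr_eq0 ED; apply/eqP.
  by rewrite (eq_udiag F d0) udiag0.
have [//|di0] := eqVneq (d i) 0.
pose v := row i F.
have vD : v *m (P - Q) = d i *: v.
  rewrite ED /udiag !mulmxA -row_mul (unitarymxP uF) row1 -rowE.
  by rewrite row_diag_mx -scalemxAl -rowE mxE.
have Dv : (P - Q) *m v^t* = d i *: v^t*.
  have /(congr1 (fun M => M^t*)) := vD.
  rewrite adjmxM adjmxB hP hQ adjmxZ => ->.
  by rewrite (CrealP (spectral_diag_real i hD)).
have key : (P - Q) *m P + Q *m (P - Q) = 0.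
  by rewrite mulmxBl mulmxBr addrA subrK PQ subrr.
have : d i * (qform P v + qform Q v) = 0.
  have := congr1 (fun M => qform M v) key.
  rewrite qformD (_ : qform 0 v = 0) => [<-|]; last first.
    by rewrite /qform mulmx0 mul0mx mxE.
  rewrite /qform !mulmxA vD -[X in _ = _ + X]/((v *m Q *m (P - Q) *m v^t*) 0 0).
  rewrite -(mulmxA (v *m Q)) Dv -!scalemxAl -scalemxAr mulrDr.
  by congr (_ + _); rewrite [RHS]mxE.
move=> /eqP; rewrite mulf_eq0 (negPf di0) paddr_eq0; [|exact: P0|exact: Q0].
move=> /andP[/eqP Pv /eqP Qv].
have : qform (P - Q) v = 0 by rewrite qformB Pv Qv subr0.
rewrite /qform vD -scalemxAl mxE.
have /row_unitarymxP/(_ i i) := uF; rewrite dotmxE -/v => ->.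
by rewrite eqxx mulr1.
Qed.

Lemma absmx_psd {C : numClosedFieldType} n (X : 'M[C]_n) : psdmx (absmx X).
Proof. exact/sqrtmx_psd/gram_psd. Qed.

Lemma absmxK {C : numClosedFieldType} n (X : 'M[C]_n) :
  absmx X *m absmx X = X^t* *m X.
Proof. exact/sqrtmxK/gram_psd. Qed.

Lemma psdmx_udiag {C : numClosedFieldType} n (P : 'M[C]_n) : psdmx P ->
  exists F (d : 'I_n -> C),
    [/\ F \is unitarymx, forall i, 0 <= d i & P = udiag F d].
Proof.
move=> Ppsd; exists (spectralmx P), (spectral_diag P 0); split.
- exact: spectral_unitarymx.
- by move=> i; apply: spectral_diag_ge0.
- by apply: udiag_spectral; case: Ppsd.
Qed.

Lemma symabsmx_psd {C : numClosedFieldType} n (X : 'M[C]_n) :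
  psdmx (symabsmx X).
Proof.
apply: psdmxZ; first by rewrite invr_ge0 ler0n.
by apply: psdmxD; apply: absmx_psd.
Qed.

(** The right-hand side is positive semidefinite, and the condition on W^t* W
    makes its square equal to X X^t*.  That condition covers both a unitary W
    and the partial isometry of [polar_decomposition]. *)
Lemma absmx_adj {C : numClosedFieldType} n (X W : 'M[C]_n) :
  X = W *m absmx X -> W^t* *m W *m absmx X = absmx X ->
  absmx (X^t*) = W *m absmx X *m W^t*.
Proof.
move=> EX WP; have [/hermsymmx_adjP hP _] := absmx_psd X.
apply: psdmx_sqr_inj; [exact: absmx_psd|exact/psdmx_conj/absmx_psd|].
rewrite absmxK trmxCK {1 2}EX.
move: (absmx X) WP hP => P WP hP.
by rewrite adjmxM hP -{2}WP !mulmxA.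
Qed.

(** The factor W is X times the pseudo-inverse of the modulus, a partial
    isometry.  It need not be extended to a unitary matrix, since
    [absmx_adj] only asks that W^t* W fix the modulus. *)
Lemma polar_decomposition {C : numClosedFieldType} n (X : 'M[C]_n) :
  exists2 W : 'M[C]_n, X = W *m absmx X & W^t* *m W *m absmx X = absmx X.
Proof.
have [F [d [uF d0 EP]]] := psdmx_udiag (absmx_psd X).
pose G e := udiag F e; pose g i := (d i)^-1.
have XX : X^t* *m X = G (fun i => d i * d i) by rewrite -absmxK EP udiagM.
have g_real i : (g i)^* = g i by rewrite geC0_conj // invr_ge0.
exists (X *m G g); last first.
  rewrite adjmxM mulmxA -[_ *m _ *m X]mulmxA XX udiag_adj EP !udiagM //.
  apply: eq_udiag => i; rewrite g_real /g.
  have [->|di0] := eqVneq (d i) 0; first by rewrite !mulr0.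
  by rewrite mulKf // mulfV // mul1r.
(* It remains to see that X vanishes on the kernel of its modulus. *)
rewrite -mulmxA EP udiagM //; apply/eqP; rewrite -subr_eq0; apply/eqP.
have -> : X - X *m G (fun i => g i * d i) = X *m G (fun i => (d i == 0)%:R).
  rewrite -[X in X - _]mulmx1 -mulmxBr -(udiag1 uF) udiagB; congr (_ *m _).
  apply: eq_udiag => i.
  by rewrite /g; have [->|di0] := eqVneq; rewrite ?mulr0 ?subr0 // mulVf ?subrr.
apply: adjmx_mul_eq0.
rewrite adjmxM mulmxA -[_ *m _ *m X]mulmxA XX udiag_adj !udiagM //.
rewrite (eq_udiag F (e := fun=> 0)) ?udiag0 // => i.
by have [->|di0] := eqVneq (d i) 0; rewrite ?mulr0 ?mul0r.
Qed.

(** * The quadratic form of the symmetrized modulus *)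

(** With D the square root of the modulus of X = W D D, the form qform X u is
    the inner product of p = u W D and q = u D, while 2 * symabsmx X takes the
    value p p^t* + q q^t* at u; the difference of the two sides is the squared
    norm of q - z p.  The left-hand side is twice the real part of z * qform X u. *)
Lemma qform_symabsmx {C : numClosedFieldType} n (X : 'M[C]_n) (z : C) u :
  z * z^* = 1 ->
  z * qform X u + (z * qform X u)^* <= 2 * qform (symabsmx X) u.
Proof.
move=> zz; have [W EX WP] := polar_decomposition X.
rewrite /symabsmx (absmx_adj EX WP) qformZ mulrA mulfV ?pnatr_eq0 // mul1r.
rewrite qformD qform_conj.
have [F [d [uF d0 EP]]] := psdmx_udiag (absmx_psd X).
pose D := udiag F (fun i => sqrtC (d i)).
have hD : D^t* = D.
  by rewrite udiag_adj; apply: eq_udiag => i; rewrite geC0_conj // sqrtC_ge0.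
have DD : absmx X = D *m D.
  by rewrite EP udiagM //; apply: eq_udiag => i; rewrite -expr2 sqrtCK.
clearbody D.
pose p := u *m W *m D; pose q := u *m D.
have -> : qform X u = (p *m q^t*) 0 0.
  by rewrite /qform {1}EX DD /p /q adjmxM hD !mulmxA.
have -> : qform (absmx X) u = (q *m q^t*) 0 0.
  by rewrite /qform DD /q adjmxM hD !mulmxA.
have -> : qform (absmx X) (u *m W) = (p *m p^t*) 0 0.
  by rewrite /qform DD /p !adjmxM hD !mulmxA.
clearbody p q.
rewrite !mxE -subr_ge0 mulr_sumr rmorph_sum /= -!big_split -sumrB /=.
apply: sumr_ge0 => i _; rewrite !mxE.
suff -> : q 0 i * (q 0 i)^* + p 0 i * (p 0 i)^* -
    (z * (p 0 i * (q 0 i)^*) + (z * (p 0 i * (q 0 i)^*))^*) =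
    `|q 0 i - z * p 0 i| ^+ 2 by rewrite exprn_ge0.
rewrite normCK rmorphB !rmorphM /= conjCK mulrBr !mulrBl.
have -> : z * p 0 i * (z^* * (p 0 i)^*) = p 0 i * (p 0 i)^*.
  by rewrite mulrACA zz mul1r.
by ring.
Qed.

(** * Counting eigenvalues *)

Lemma size_eigenvalues {C : numClosedFieldType} n (A : 'M[C]_n) :
  size (eigenvalues A) = n.
Proof.
rewrite /eigenvalues; case: closed_field_poly_normal => s /= Es.
have := congr1 (size \o polyseq) Es; rewrite /= size_char_poly.
by rewrite (monicP (char_poly_monic A)) scale1r size_prod_XsubC => -[].
Qed.

Lemma lambda_desc_default {C : numClosedFieldType} n (A : 'M[C]_n) k :
  (n < k)%N -> lambda_desc k A = 0.
Proof.
case: k => // k nk.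
by rewrite /lambda_desc nth_default // size_sort size_eigenvalues.
Qed.

Lemma count_eigenvalues_udiag {C : numClosedFieldType} n (F : 'M[C]_n)
    (d : 'I_n -> C) (p : pred C) :
  F \is unitarymx ->
  count p (sort >=%R (eigenvalues (udiag F d))) = #|[pred i | p (d i)]|.
Proof.
move=> uF; rewrite count_sort (permP (eigenvalues_udiag d uF)).
rewrite count_map enumT -size_filter cardE; congr size.
Qed.

Lemma sorted_eigenvalues {C : numClosedFieldType} n (F : 'M[C]_n)
    (d : 'I_n -> C) :
  F \is unitarymx -> (forall i, d i \is Num.real) ->
  sorted >=%R (sort >=%R (eigenvalues (udiag F d))).
Proof.
move=> uF dR; apply: (@sort_sorted_in _ Num.real).
  by move=> x y xR yR; apply: real_leVge.
rewrite (perm_all _ (eigenvalues_udiag d uF)).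
by apply/allP => _ /codomP[i ->]; apply: dR.
Qed.

Lemma lambda_desc_codom {C : numClosedFieldType} n (F : 'M[C]_n)
    (d : 'I_n -> C) k :
  F \is unitarymx -> (0 < k <= n)%N ->
  exists i, lambda_desc k (udiag F d) = d i.
Proof.
case: k => // k uF kn; apply/codomP.
rewrite -(perm_mem (eigenvalues_udiag d uF)) -(mem_sort >=%R).
by apply: mem_nth; rewrite size_sort size_eigenvalues.
Qed.

Lemma ge_lambda_desc {C : numClosedFieldType} n (F : 'M[C]_n)
    (d : 'I_n -> C) (t : C) k :
  F \is unitarymx -> (forall i, d i \is Num.real) ->
  (0 < k <= #|[pred i | (t <= d i)%R]|)%N -> t <= lambda_desc k (udiag F d).
Proof.
case: k => // k uF dR.
rewrite -(count_eigenvalues_udiag d (fun x => t <= x) uF) => kn.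
(* The list is nondecreasing for the dual order of C. *)
exact: (@Order.PreorderTheory.nth_count_le _ C^d t 0 _ k
         (sorted_eigenvalues uF dR)).
Qed.

(** The first k entries of a nonincreasing list are at least its k-th entry. *)
Lemma card_ge_lambda_desc {C : numClosedFieldType} n (F : 'M[C]_n)
    (d : 'I_n -> C) k :
  F \is unitarymx -> (forall i, d i \is Num.real) -> (0 < k <= n)%N ->
  (k <= #|[pred i | (lambda_desc k (udiag F d) <= d i)%R]|)%N.
Proof.
case: k => // k uF dR kn; set t := lambda_desc _ _.
rewrite -(count_eigenvalues_udiag d (fun x => t <= x) uF).
have := sorted_eigenvalues uF dR.
have : size (sort >=%R (eigenvalues (udiag F d))) = n.
  by rewrite size_sort size_eigenvalues.
rewrite {}/t /lambda_desc /=; move: (sort _ _) => s sz ss.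
rewrite -{2}(cat_take_drop k.+1 s) count_cat.
suff -> : count (fun x => s`_k <= x) (take k.+1 s) = k.+1 by rewrite leq_addr.
have szt : size (take k.+1 s) = k.+1.
  by rewrite size_take_min sz; apply/minn_idPl.
rewrite -[RHS]szt; apply/eqP; rewrite -all_count; apply/(all_nthP 0) => i.
rewrite szt => ik; rewrite nth_take //.
have tr : transitive (>=%R : rel C).
  by move=> x y z yx zx; apply: le_trans zx yx.
have rf : reflexive (>=%R : rel C) by move=> x; apply: lexx.
by apply: (sorted_leq_nth tr rf 0 ss); rewrite ?inE ?sz // (leq_trans ik kn).
Qed.

(** The counting form of the Courant-Fischer principle: if fewer than p
    eigenvalues were at least t, some nonzero vector a B of the row space would
    be orthogonal to their eigenvectors, and at such a vector the form is
    smaller than t times the squared norm. *)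
Lemma card_ge_subspace {C : numClosedFieldType} n p (F : 'M[C]_n)
    (d : 'I_n -> C) (t : C) (B : 'M[C]_(p, n)) :
  F \is unitarymx -> (forall i, d i \is Num.real) -> t \is Num.real ->
  row_free B ->
  (forall a : 'rV_p, t * (a *m B *m (a *m B)^t*) 0 0
     <= qform (udiag F d) (a *m B)) ->
  (p <= #|[pred i | (t <= d i)%R]|)%N.
Proof.
move=> uF dR tR Bfree Bt; set J := [pred i | _].
rewrite leqNgt; apply/negP => Jp.
(* The coordinates of a B along the eigenvectors with eigenvalue at least t are
   the entries of a N. *)
pose N := B *m F^t* *m (\matrix_(i < n, j < #|J|) (i == enum_val j)%:R).
have : ~~ row_free N.
  by rewrite /row_free neq_ltn (leq_ltn_trans (rank_leq_col _)).
case/negP; apply: inj_row_free => a aN.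
pose b := a *m B *m F^t*.
have bJ i : i \in J -> b 0 i = 0.
  move=> iJ; have /rowP/(_ (enum_rank_in iJ i)) := aN.
  rewrite !mulmxA -/b !mxE (bigD1 i) //= big1 => [|k ki].
    by rewrite !mxE enum_rankK_in // eqxx mulr1 addr0.
  by rewrite !mxE enum_rankK_in // (negPf ki) mulr0.
have := Bt a; rewrite qform_udiag -/b.
rewrite (gram_mx00_unitary _ uF) -/b.
rewrite mulr_sumr -subr_le0 -sumrB => sum_le0.
have b0 i : b 0 i = 0.
  have [iJ|] := boolP (i \in J); first exact: bJ.
  rewrite inE -real_ltNge // => lt_it.
  have term_ge0 k : true -> 0 <= t * `|b 0 k| ^+ 2 - d k * `|b 0 k| ^+ 2.
    move=> _; rewrite -mulrBl; have [kJ|] := boolP (k \in J).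
      by rewrite bJ // normr0 expr0n mulr0.
    rewrite inE -real_ltNge // => lt_kt.
    by rewrite mulr_ge0 ?exprn_ge0 // subr_ge0 ltW.
  have : \sum_k (t * `|b 0 k| ^+ 2 - d k * `|b 0 k| ^+ 2) == 0.
    by rewrite eq_le sum_le0 sumr_ge0.
  rewrite psumr_eq0 // => /allP/(_ i (mem_index_enum i)) /=.
  rewrite -mulrBl mulf_eq0 subr_eq0 expf_eq0 /= normr_eq0.
  by rewrite eq_sym (lt_eqF lt_it) => /eqP.
apply: (row_free_inj Bfree); rewrite /= mul0mx.
have -> : a *m B = b *m F by rewrite /b mulmxKtV.
by rewrite (_ : b = 0) ?mul0mx //; apply/rowP => i; rewrite b0 mxE.
Qed.

(** Weyl monotonicity: the form of [udiag F k] is at least t times the squared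
    norm on the span of the rows of F that belong to eigenvalues at least t, and
    the larger form inherits this bound. *)
Lemma card_ge_udiag_mono {C : numClosedFieldType} n (F G : 'M[C]_n)
    (k d : 'I_n -> C) (t : C) :
  F \is unitarymx -> G \is unitarymx -> (forall i, d i \is Num.real) ->
  t \is Num.real ->
  (forall u, qform (udiag F k) u <= qform (udiag G d) u) ->
  (#|[pred i | (t <= k i)%R]| <= #|[pred i | (t <= d i)%R]|)%N.
Proof.
move=> uF uG dR tR le_kd; set Q := [pred i | t <= k i].
pose B : 'M[C]_(#|Q|, n) := \matrix_(a < #|Q|) row (enum_val a) F.
have BF : B *m F^t* = \matrix_(a, i) (enum_val a == i)%:R.
  apply/row_matrixP => a; rewrite row_mul rowK -row_mul (unitarymxP uF).
  by apply/rowP => i; rewrite !mxE.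
apply: (card_ge_subspace uG dR tR (B := B)) => [|a].
  apply: inj_row_free => a aB.
  have := congr1 (fun M => M *m F^t*) aB; rewrite -mulmxA BF mul0mx => a0.
  apply/rowP => x; have /rowP/(_ (enum_val x)) := a0.
  rewrite !mxE (bigD1 x) //= big1 => [|y yx].
    by rewrite mxE eqxx mulr1 addr0.
  by rewrite mxE (inj_eq enum_val_inj) (negPf yx) mulr0.
apply: le_trans (le_kd _).
rewrite qform_udiag (gram_mx00_unitary _ uF) mulr_sumr; apply: ler_sum => i _.
have [iQ|iQ] := boolP (i \in Q).
  by apply: ler_wpM2r iQ; rewrite exprn_ge0.
suff -> : (a *m B *m F^t*) 0 i = 0 by rewrite normr0 expr0n !mulr0.
rewrite -mulmxA BF mxE big1 // => x _; rewrite mxE.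
by case: eqP iQ => [<-|]; rewrite ?enum_valP ?mulr0.
Qed.

(** * Polar Hermitian matrices *)

(** When n = 0 the scalar is unconstrained, but it may be replaced by 1, since
    all matrices are equal. *)
Lemma polar_hermitianP {C : numClosedFieldType} n (S : 'M[C]_n) :
  polar_hermitian S -> exists c U,
    [/\ c * c^* = 1, U^t* = U, U *m U = 1%:M & S = c *: (U *m absmx S)].
Proof.
case=> V [uV ES [c [U [/hermsymmx_adjP hU uU EV]]]].
have UU : U *m U = 1%:M by rewrite -[X in _ *m X]hU; apply/unitarymxP.
case: n => [|n] in S V uV ES U hU uU EV UU *.
  by exists 1, U; split=> //; rewrite ?rmorph1 ?mulr1 // flatmx0 [RHS]flatmx0.
exists c, U; split=> //; last by rewrite scalemxAl -EV.
have /unitarymxP/matrixP/(_ 0 0) := uV.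
by rewrite EV adjmxZ hU -scalemxAl -scalemxAr UU scalerA !mxE mulr1.
Qed.

(** Here K = (U P + P U) / 2, with P the modulus of S = c U P, is the matrix
    [udiag F k].  Its square is that of symabsmx S = (P + U P U) / 2, so that by
    uniqueness of square roots the eigenvalues of the latter are the absolute
    values of those of K.  The bounds are the hypothesis for z = c^* and for
    z = - c^*. *)
Lemma polar_hermitian_comparison {C : numClosedFieldType} n (S H : 'M[C]_n) :
  polar_hermitian S ->
  (forall z u, z * z^* = 1 ->
     z * qform S u + (z * qform S u)^* <= 2 * qform H u) ->
  exists F (k : 'I_n -> C),
    [/\ F \is unitarymx, forall i, k i \is Num.real,
        symabsmx S = udiag F (fun i => `|k i|),
        forall u, qform (udiag F k) u <= qform H u &
        forall u, - qform (udiag F k) u <= qform H u].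
Proof.
move=> /polar_hermitianP[c [U [cc hU UU ES]]] leH.
have Ppsd := absmx_psd S; have [/hermsymmx_adjP hP _] := Ppsd.
have ET : symabsmx S = 2^-1 *: (absmx S + U *m absmx S *m U).
  rewrite /symabsmx; congr (_ *: (_ + _)).
  rewrite (@absmx_adj _ _ _ (c *: U)) -?scalemxAl // adjmxZ hU.
    by rewrite -scalemxAr scalerA cc scale1r.
  rewrite -!scalemxAl -!scalemxAr -!scalemxAl scalerA mulrC cc scale1r.
  by rewrite UU mul1mx.
have Tpsd := symabsmx_psd S.
move: (absmx S) ES Ppsd hP ET => P ES Ppsd hP ET.
pose K := 2^-1 *: (U *m P + P *m U).
have qK u : 2 * qform K u = c^* * qform S u + (c^* * qform S u)^*.
  rewrite /K qformZ mulrA mulfV ?pnatr_eq0 // mul1r qformD ES qformZ mulrA.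
  by rewrite [c^* * c]mulrC cc mul1r -qform_adj adjmxM hU hP.
have hK : K \is hermsymmx.
  apply/hermsymmx_adjP; rewrite /K adjmxZ adjmxD !adjmxM hU hP addrC.
  by rewrite geC0_conj // invr_ge0 ler0n.
pose F := spectralmx K; pose k := spectral_diag K 0.
have EK : K = udiag F k := udiag_spectral hK.
have uF : F \is unitarymx := spectral_unitarymx _.
have kR i : k i \is Num.real := spectral_diag_real i hK.
exists F, k; split=> //.
- apply: psdmx_sqr_inj => //; first exact: udiag_psd.
  have -> : udiag F (fun i => `|k i|) *m udiag F (fun i => `|k i|) = K *m K.
    rewrite EK !udiagM //; apply: eq_udiag => i.
    by rewrite -!expr2 real_normK.
  rewrite ET /K -!scalemxAl -!scalemxAr; congr (_ *: (_ *: _)).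
  rewrite !mulmxDl !mulmxDr !mulmxA.
  by rewrite -!(mulmxA _ U U) UU !mulmx1 addrC.
- move=> u; rewrite -EK -(ler_pM2l (ltr0n C 2)) qK leH //.
  by rewrite conjCK mulrC.
- move=> u; rewrite -EK -(ler_pM2l (ltr0n C 2)) mulrN qK opprD -rmorphN -mulNr.
  by rewrite leH // rmorphN /= conjCK mulrNN mulrC.
Qed.

Lemma pigeonhole_sign {C : numClosedFieldType} (I : finType) (k : I -> C) t j :
  (forall i, k i \is Num.real) ->
  (1 + 2 * j <= #|[pred i | (t <= `|k i|)%R]|)%N ->
  exists s : bool, (1 + j <= #|[pred i | (t <= (-1) ^+ s * k i)%R]|)%N.
Proof.
move=> kR; set A := [pred i | _] => cA.
pose Q s := [pred i | (t <= (-1) ^+ s * k i)%R].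
have : (#|A| <= #|Q false| + #|Q true|)%N.
  rewrite -cardUI (leq_trans _ (leq_addr _ _)) //.
  apply/subset_leq_card/subsetP.
  move=> i; rewrite !inE expr0 expr1 mul1r mulN1r => ti.
  by case: (real_ge0P (kR i)) ti => _ ->; rewrite ?orbT.
move=> cQ; have [c0|c0] := leqP (1 + j) #|Q false|; first by exists false.
exists true; rewrite -/(Q true).
rewrite -(leq_add2l #|Q false|); apply: leq_trans _ (leq_trans cA cQ).
by rewrite mul2n -addnn addnCA leq_add2l leq_add2r -ltnS.
Qed.

(** * The eigenvalue inequality *)

(** When 1 + 2 j > n the left-hand side is 0 by convention, and the right-hand
    side is 0 or an eigenvalue of the positive semidefinite matrix H. *)
Lemma lambda_desc_symabsmx_le {C : numClosedFieldType} n (S H : 'M[C]_n) j :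
  polar_hermitian S -> psdmx H ->
  (forall z u, z * z^* = 1 ->
     z * qform S u + (z * qform S u)^* <= 2 * qform H u) ->
  lambda_desc (1 + 2 * j) (symabsmx S) <= lambda_desc (1 + j) H.
Proof.
move=> hS Hpsd leH; have [G [d [uG d0 EH]]] := psdmx_udiag Hpsd.
have dR i : d i \is Num.real by rewrite ger0_real.
have [jn|nj] := leqP (1 + 2 * j) n; last first.
  rewrite lambda_desc_default //.
  have [jn|/lambda_desc_default->//] := leqP (1 + j) n.
  by have [//|i] := @lambda_desc_codom _ _ G d (1 + j) uG; rewrite EH => ->.
have [F [k [uF kR ET leK leNK]]] := polar_hermitian_comparison hS leH.
have akR i : `|k i| \is Num.real by apply: normr_real.
rewrite ET EH; set t := lambda_desc (1 + 2 * j) _.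
have tR : t \is Num.real.
  have [|i] := @lambda_desc_codom _ _ F (fun i => `|k i|) (1 + 2 * j) uF.
    by rewrite jn.
  by rewrite /t => ->; apply: akR.
have [|s cQ] := @pigeonhole_sign _ _ k t j kR.
  by apply: card_ge_lambda_desc.
apply: ge_lambda_desc => //; rewrite /=.
apply: leq_trans cQ _.
apply: (card_ge_udiag_mono uF uG) => // u.
have -> : qform (udiag F (fun i => (-1) ^+ s * k i)) u
    = (-1) ^+ s * qform (udiag F k) u.
  rewrite !qform_udiag mulr_sumr; apply: eq_bigr => i _.
  by rewrite [RHS]mulrA.
by rewrite -EH; case: (s); rewrite ?expr1 ?expr0 ?mulN1r ?mul1r.
Qed.

Theorem corollary3p5 (R : realType) (m n : nat) (X : 'I_m -> 'M[R[i]]_n)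
    (hX : polar_hermitian (\sum_(k < m) X k)) (j : nat) :
  lambda_desc (1 + 2 * j)%N (symabsmx (\sum_(k < m) X k))
    <= lambda_desc (1 + j)%N (\sum_(k < m) symabsmx (X k)).
Proof.
apply: lambda_desc_symabsmx_le => // [|z u zz].
  apply: (big_ind (@psdmx _ n)) => [|A B|k _];
    [exact: psdmx0|exact: psdmxD|exact: symabsmx_psd].
rewrite !qform_sum !mulr_sumr rmorph_sum -big_split /=.
by apply: ler_sum => k _; apply: qform_symabsmx.
Qed.
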